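(* Let $0\le\rho\in C_c(\mathbb{R})$ be nontrivial (not identically zero). For all $n\ge1$, let $\varphi_n$ be the viscosity solution of $$\partial_t\varphi=\left(\partial^2_{xx}\varphi\right)^+\quad\text{in }\mathbb{R}\times(0,\infty)$$ with initial data $\varphi_n(x,0)=n\rho(nx)$. Then $$\lim_{n\to\infty}\varphi_n(x,t)=\infty\qquad\forall x\in\mathbb{R},\ \forall t>0.$$
   Context: $C_c$ denotes continuous functions with compact support, $C_b$ bounded continuous functions, $r^+=\max\{r,0\}$, $\mathbb{R}^+=[0,\infty)$. The viscosity solution with initial data $\varphi_0\in C_b(\mathbb{R})$ is the unique $\varphi\in C_b(\mathbb{R}\times\mathbb{R}^+)$ with $\varphi(\cdot,0)=\varphi_0$ such that, for every $\phi\in C^\infty(\mathbb{R}\times\mathbb{R}^+)$ and $(x,t)\in\mathbb{R}\times(0,\infty)$, $\partial_t\phi(x,t)\le(\partial^2_{xx}\phi(x,t))^+$ if $(x,t)$ is a local maximum of $\varphi-\phi$, and $\ge$ if it is a local minimum of $\varphi-\phi$. *)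

(* Defs.v *)
From HB Require Import structures.
From mathcomp Require Import all_boot all_order all_algebra.
From mathcomp Require Import all_classical all_reals all_analysis.

Set Implicit Arguments.
Unset Strict Implicit.
Unset Printing Implicit Defensive.

Import Order.TTheory GRing.Theory Num.Theory.
Import numFieldNormedType.Exports.

Local Open Scope classical_set_scope.
Local Open Scope ring_scope.

(* Space-time points are pairs [(x, t)]; functions on [R * R^+] are encoded as
   total functions on [R * R] whose values at negative times are irrelevant. *)
Definition halfspace (R : realType) : set (R * R) := [set p | 0 <= p.2].

Arguments halfspace : clear implicits.

Definition Cb_halfspace (R : realType) (u : R * R -> R) : Prop :=
  {within halfspace R, continuous u} /\ [bounded u p | p in halfspace R].

Definition dx (R : realType) (f : R * R -> R) : R * R -> R :=
  'D_((1, 0) : R * R) f.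

Definition dt (R : realType) (f : R * R -> R) : R * R -> R :=
  'D_((0, 1) : R * R) f.

Fixpoint Ck (R : realType) (k : nat) (f : R * R -> R) : Prop :=
  if k is k'.+1 then
    [/\ continuous f,
        forall p, derivable f p (1, 0), forall p, derivable f p (0, 1),
        Ck k' (dx f) & Ck k' (dt f)]
  else continuous f.

(* Smoothness up to the boundary: [phi] is, on the closed half-space, the
   restriction of a smooth function on the whole plane. *)
Definition Cinfty_halfspace (R : realType) (phi : R * R -> R) : Prop :=
  exists2 g : R * R -> R,
    forall k, Ck k g & forall p, halfspace R p -> phi p = g p.

Definition local_max (R : realType) (f : R * R -> R) (p : R * R) : Prop :=
  \forall q \near within (halfspace R) (nbhs p), f q <= f p.

Definition local_min (R : realType) (f : R * R -> R) (p : R * R) : Prop :=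
  \forall q \near within (halfspace R) (nbhs p), f p <= f q.

Definition viscosity_solution (R : realType) (u0 : R -> R) (u : R * R -> R)
    : Prop :=
  [/\ Cb_halfspace u,
      forall x, u (x, 0) = u0 x
    & forall (phi : R * R -> R) (x t : R), Cinfty_halfspace phi -> 0 < t ->
        (local_max (u \- phi) (x, t) ->
           dt phi (x, t) <= Num.max (dx (dx phi) (x, t)) 0) /\
        (local_min (u \- phi) (x, t) ->
           Num.max (dx (dx phi) (x, t)) 0 <= dt phi (x, t))].

(* Main.v *)
Require Import Defs.
From HB Require Import structures.
From mathcomp Require Import all_boot all_order all_algebra.
From mathcomp Require Import all_classical all_reals all_analysis.
From mathcomp Require Import ring lra.

Set Implicit Arguments.
Unset Strict Implicit.
Unset Printing Implicit Defensive.

Import Order.TTheory GRing.Theory Num.Theory.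
Import numFieldNormedType.Exports.

Local Open Scope classical_set_scope.
Local Open Scope ring_scope.

(** Solutions grow because the right-hand side of the equation is nonnegative:
the peak of the initial datum never sinks, and its growing height is carried
to every other point by diffusion, which the equation dominates.

Every bound comes from the same comparison principle ([comparison]).  Let [w]
be smooth, let [D] be a closed part of the half-space, and suppose that at
each point of [D] where [u < w] the function [w] is a strict classical
subsolution, and that these points are bounded, have positive time and are
interior to [D].  Then [w <= u] on [D]: otherwise [u - w] has a negative
minimum on [D], at a point where [w] is an admissible test function, and the
supersolution inequality contradicts strictness.

- With [w = m - K (x - b)^2 - eps t], which decreases in time, a downward
  paraboloid below the initial datum stays below the solution forever
  ([paraboloid_le]).  It follows that [phi n >= 0] and that, for
  [r = rho x0 / 2 > 0] and [a = x0 / n], [phi n (a, t) >= n r] at all times.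

- Suppose that [u >= 0], and that [u >= M] on the line [x = a].  Put
  [z = |x - a|].  On one side of that line, take
  [w = M (al (exp (k^2 t - k z) - 1) - be exp (2 k^2 t))].  The exponential of
  [k^2 t - k z] solves the heat equation, and the last term makes [w] a strict
  subsolution, bounded above by [M] on the line, and negative for large times.
  The resulting bound at [(x, t)] is [M] times a positive constant which
  depends on [t] and on an upper bound of [|x - a|] only
  ([half_line_barrier_le]).

With [M = n r] and [|x - x0 / n| <= |x| + |x0|], this gives
[phi n (x, t) >= n r c] with [c > 0] independent of [n]. *)

(** * Smooth test functions *)

(** A family of functions of [(x, t)] that contains the two kinds of barriers
and is closed under both partial derivatives, so that all its members are
smooth. *)
Definition test_fun (R : realType) (c0 c1 c2 c3 c4 a b g c5 d : R)
    (p : R * R) : R :=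
  c0 + c1 * p.1 + c2 * p.1 ^+ 2 + c3 * p.2
  + c4 * expR (a * p.2 + b * p.1 + g) + c5 * expR (d * p.2).

(** A partial derivative is the ordinary derivative along a coordinate line. *)
Lemma derivable_slice1 (R : realType) (f : R * R -> R) (x t l : R) :
  is_derive x 1 (fun y => f (y, t)) l ->
  derivable f (x, t) (1, 0) /\ dx f (x, t) = l.
Proof.
move=> [df <-]; rewrite /derivable /dx /derive /=.
have -> : (fun h : R => h^-1 *: ((f \o shift (x, t)) (h *: ((1, 0) : R * R))
    - f (x, t)))
  = (fun h : R => h^-1 *: (((fun y => f (y, t)) \o shift x) (h *: 1)
    - f (x, t))).
  by apply/funext => h /=; rewrite /shift /=; congr (_ *: (f (_, _) - _));
    rewrite /= scaler0 add0r.
by [].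
Qed.

Lemma derivable_slice2 (R : realType) (f : R * R -> R) (x t l : R) :
  is_derive t 1 (fun s => f (x, s)) l ->
  derivable f (x, t) (0, 1) /\ dt f (x, t) = l.
Proof.
move=> [df <-]; rewrite /derivable /dt /derive /=.
have -> : (fun h : R => h^-1 *: ((f \o shift (x, t)) (h *: ((0, 1) : R * R))
    - f (x, t)))
  = (fun h : R => h^-1 *: (((fun s => f (x, s)) \o shift t) (h *: 1)
    - f (x, t))).
  by apply/funext => h /=; rewrite /shift /=; congr (_ *: (f (_, _) - _));
    rewrite /= scaler0 add0r.
by [].
Qed.

Lemma is_derive_expR_affine (R : realType) (a b x : R) :
  is_derive x 1 (fun y => expR (a * y + b)) (a * expR (a * x + b)).
Proof.
have h : is_derive x 1 (fun y : R => a * y + b) a.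
  by apply: is_derive_eq; rewrite addr0 -[_ *: _]/(a * 1) mulr1.
have := @is_derive1_comp R expR (fun y => a * y + b) x _ _ (is_derive_expR _) h.
by rewrite mulrC.
Qed.

Lemma dx_test_fun (R : realType) (c0 c1 c2 c3 c4 a b g c5 d : R) (p : R * R) :
  derivable (test_fun c0 c1 c2 c3 c4 a b g c5 d) p (1, 0) /\
  dx (test_fun c0 c1 c2 c3 c4 a b g c5 d) p =
  test_fun c1 (2 * c2) 0 0 (c4 * b) a b g 0 d p.
Proof.
case: p => x t; apply: derivable_slice1; rewrite /test_fun /=.
have -> : (fun y : R => c0 + c1 * y + c2 * y ^+ 2 + c3 * t +
    c4 * expR (a * t + b * y + g) + c5 * expR (d * t)) =
  (fun y : R => c0 + c1 * y + c2 * y ^+ 2 + c3 * t +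
    c4 * expR (b * y + (a * t + g)) + c5 * expR (d * t)).
  by apply/funext => y; congr (_ + _ * expR _ + _); ring.
have := is_derive_expR_affine b (a * t + g) x => ?.
apply: is_derive_eq.
rewrite /GRing.scale /=.
have -> : a * t + b * x + g = b * x + (a * t + g) by ring.
ring.
Qed.

Lemma dt_test_fun (R : realType) (c0 c1 c2 c3 c4 a b g c5 d : R) (p : R * R) :
  derivable (test_fun c0 c1 c2 c3 c4 a b g c5 d) p (0, 1) /\
  dt (test_fun c0 c1 c2 c3 c4 a b g c5 d) p =
  test_fun c3 0 0 0 (c4 * a) a b g (c5 * d) d p.
Proof.
case: p => x t; apply: derivable_slice2; rewrite /test_fun /=.
have -> : (fun s : R => c0 + c1 * x + c2 * x ^+ 2 + c3 * s +
    c4 * expR (a * s + b * x + g) + c5 * expR (d * s)) =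
  (fun s : R => c0 + c1 * x + c2 * x ^+ 2 + c3 * s +
    c4 * expR (a * s + (b * x + g)) + c5 * expR (d * s + 0)).
  by apply/funext => y; congr (_ + _ * expR _ + _ * expR _); ring.
have := is_derive_expR_affine a (b * x + g) t => ?.
have := is_derive_expR_affine d 0 t => ?.
apply: is_derive_eq.
rewrite /GRing.scale /= addr0 (addrA (a * t)).
ring.
Qed.

Lemma continuous_test_fun (R : realType) (c0 c1 c2 c3 c4 a b g c5 d : R) :
  continuous (test_fun c0 c1 c2 c3 c4 a b g c5 d).
Proof.
move=> p; rewrite /test_fun.
have cx : (fun q : R * R => q.1) @ p --> p.1 by exact: cvg_fst.
have ct : (fun q : R * R => q.2) @ p --> p.2 by exact: cvg_snd.
have cM c (h : R * R -> R) : h @ p --> h p ->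
    (fun q => c * h q) @ p --> c * h p.
  by move=> ?; apply: cvgM => //; exact: cvg_cst.
have cE (h : R * R -> R) : h @ p --> h p ->
    (fun q => expR (h q)) @ p --> expR (h p).
  by move=> ?; apply: continuous_cvg => //; exact: continuous_expR.
apply: cvgD; last exact/cM/cE/cM.
apply: cvgD.
  apply: cvgD; last exact: cM.
  apply: cvgD; last by apply: (cM _ (fun q => q.1 ^+ 2)); exact: cvgM.
  by apply: cvgD; [exact: cvg_cst|exact: cM].
apply: (cM _ (fun q => expR (a * q.2 + b * q.1 + g))).
apply: (cE (fun q => a * q.2 + b * q.1 + g)).
apply: cvgD; last exact: cvg_cst.
by apply: cvgD; exact: cM.
Qed.

Lemma Ck_test_fun (R : realType) k (c0 c1 c2 c3 c4 a b g c5 d : R) :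
  Ck k (test_fun c0 c1 c2 c3 c4 a b g c5 d).
Proof.
elim: k c0 c1 c2 c3 c4 c5 => [|k IH] c0 c1 c2 c3 c4 c5 /=.
  exact: continuous_test_fun.
split; first exact: continuous_test_fun.
- by move=> p; case: (dx_test_fun c0 c1 c2 c3 c4 a b g c5 d p).
- by move=> p; case: (dt_test_fun c0 c1 c2 c3 c4 a b g c5 d p).
- suff -> : dx (test_fun c0 c1 c2 c3 c4 a b g c5 d) =
    test_fun c1 (2 * c2) 0 0 (c4 * b) a b g 0 d by exact: IH.
  by apply/funext => p; case: (dx_test_fun c0 c1 c2 c3 c4 a b g c5 d p).
- suff -> : dt (test_fun c0 c1 c2 c3 c4 a b g c5 d) =
    test_fun c3 0 0 0 (c4 * a) a b g (c5 * d) d by exact: IH.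
  by apply/funext => p; case: (dt_test_fun c0 c1 c2 c3 c4 a b g c5 d p).
Qed.

Lemma dxx_test_fun (R : realType) (c0 c1 c2 c3 c4 a b g c5 d : R) (p : R * R) :
  dx (dx (test_fun c0 c1 c2 c3 c4 a b g c5 d)) p =
  2 * c2 + c4 * b ^+ 2 * expR (a * p.2 + b * p.1 + g).
Proof.
have -> : dx (test_fun c0 c1 c2 c3 c4 a b g c5 d) =
    test_fun c1 (2 * c2) 0 0 (c4 * b) a b g 0 d.
  by apply/funext => q; case: (dx_test_fun c0 c1 c2 c3 c4 a b g c5 d q).
case: (dx_test_fun c1 (2 * c2) 0 0 (c4 * b) a b g 0 d p) => _ ->.
by rewrite /test_fun; ring.
Qed.

(** * Comparison with strict subsolutions *)

(** Comparison from below on a closed part [D] of the half-space.  The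
parabolic boundary of [D] and the behaviour at infinity enter only through
the points where [u < w]. *)
Lemma comparison (R : realType) (u0 : R -> R) (u : R * R -> R)
    (u_sol : viscosity_solution u0 u)
    (D : set (R * R)) (w : R * R -> R) (L : R) :
  closed D -> D `<=` halfspace R -> (forall k, Ck k w) ->
  (forall q, D q -> u q < w q -> [/\ 0 < q.2, q.2 <= L, `|q.1| <= L,
     nbhs q D & dt w q < Num.max (dx (dx w) q) 0]) ->
  forall p, D p -> w p <= u p.
Proof.
move=> cD DH wS H p Dp; rewrite leNgt; apply/negP => up.
have [[uc _] _ uv] := u_sol.
pose B := (`[- L, L] `*` `[0, L]) `&` D.
have inB q : D q -> u q < w q -> B q.
  move=> Dq /(H q Dq)[t0 tL xL _ _]; split=> //=; split => /=.
    by rewrite in_itv /= -ler_norml.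
  by rewrite in_itv /= (ltW t0).
have cB : compact B.
  apply: compact_closedI => //; apply: compact_setX; exact: segment_compact.
have wc : continuous w by have := wS 0%N.
have cBu : {within B, continuous (u \- w)}.
  have cu : {within B, continuous u}.
    by apply: continuous_subspaceW uc => r [_ /DH].
  have cw : {within B, continuous w} by exact: continuous_subspaceT.
  by move=> q; apply: cvgB; [exact: cu|exact: cw].
have [|c] := @compact_EVT_min _ _ (u \- w) B _ cB cBu.
  by exists p; exact: inB.
rewrite inE => Bc cmin.
have uwc : (u \- w) c < 0.
  apply: le_lt_trans (cmin p _) _; first by rewrite inE; exact: inB.
  by rewrite /= subr_lt0.
have Dc : D c by case: Bc => _.
have uwc' : u c < w c by rewrite -subr_lt0.
have [t0 _ _ nD dw] := H c Dc uwc'.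
(* The minimum of [u - w] over the compact set [B] is a local minimum in the
   whole half-space: near [c], points outside [B] satisfy [w <= u], while the
   value at [c] is negative. *)
have wC : Cinfty_halfspace w by exists w.
have := (uv w c.1 c.2 wC t0).2.
rewrite -surjective_pairing => /(_ _)/wrap[].
  rewrite /local_min; near=> q.
  have Dq : D q by near: q; exact: cvg_within.
  have [uq|uq] := ltP (u q) (w q); first by apply: cmin; rewrite inE; exact: inB.
  by apply: (le_trans (ltW uwc)); rewrite /= subr_ge0.
by rewrite leNgt dw.
Unshelve. all: by end_near.
Qed.

(** * Lower bounds for solutions *)

(** A concave paraboloid below the initial datum is a stationary subsolution,
hence stays below the solution at all times. *)
Lemma paraboloid_le (R : realType) (u0 : R -> R) (u : R * R -> R)
    (u_sol : viscosity_solution u0 u) (m K b : R) : 0 < K ->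
  (forall y, m - K * (y - b) ^+ 2 <= u0 y) ->
  forall x t, 0 <= t -> m - K * (x - b) ^+ 2 <= u (x, t).
Proof.
move=> K0 hu0 x t t0.
have [[_ [C [_ hC]]] u_init _] := u_sol.
(* The term [eps * t] makes the subsolution strict and forces [u < w] into a
   bounded set. *)
suff H eps : 0 < eps -> m - K * (x - b) ^+ 2 <= u (x, t) + eps * t.
  apply/ler_addgt0Pr => e e0; have t1 : 0 < t + 1 by lra.
  apply: (le_trans (H (e / (t + 1)) (divr_gt0 e0 t1))).
  by rewrite lerD2l mulrAC ler_pdivrMr//; nra.
move=> e0.
pose w := test_fun (m - K * b ^+ 2) (2 * K * b) (- K) (- eps) 0 0 0 0 0 0.
have wE q : w q = m - K * (q.1 - b) ^+ 2 - eps * q.2.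
  by rewrite /w /test_fun; ring.
suff : w (x, t) <= u (x, t) by rewrite wE /= => ?; lra.
pose E := `|m| + `|C| + 1.
have E0 : 0 < E by rewrite /E; have := normr_ge0 m; have := normr_ge0 C; lra.
pose L := `|b| + 1 + E / K + E / eps.
apply: (comparison u_sol (D := halfspace R) (L := L)) => //.
- by apply: (preimage_closed _ (@closed_ge R 0)) => q _; exact: cvg_snd.
- by move=> k; exact: Ck_test_fun.
move=> [y s] /= s0 uw.
have uC : - (`|C| + 1) <= u (y, s).
  have : `|u (y, s)| <= `|C| + 1.
    by apply: hC => //; have := ler_norm C; lra.
  by rewrite ler_norml => /andP[].
have key : K * (y - b) ^+ 2 + eps * s < E.
  by move: uw; rewrite wE /= /E; have := ler_norm m; lra.
have sq0 := sqr_ge0 (y - b).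
have s_gt0 : 0 < s.
  rewrite lt_neqAle s0 andbT eq_sym; apply/eqP => sE.
  by move: uw; rewrite sE wE /= u_init mulr0 subr0 ltNge hu0.
have EK : (y - b) ^+ 2 < E / K by rewrite ltr_pdivlMr//; nra.
have Ee : s < E / eps by rewrite ltr_pdivlMr//; nra.
have b0 := normr_ge0 b.
split=> //.
- by rewrite /L; lra.
- have -> : y = b + (y - b) by ring.
  apply: (le_trans (ler_normD _ _)); rewrite /L.
  have : `|y - b| <= 1 + (y - b) ^+ 2.
    by rewrite -(real_normK (num_real (y - b))); have := normr_ge0 (y - b); nra.
  lra.
- apply: (filterS (P := [set q : R * R | 0 < q.2])); first by move=> q /ltW.
  apply: open_nbhs_nbhs; split=> //.
  by apply: open_comp (@open_gt R 0) => q _; exact: cvg_snd.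
- rewrite dxx_test_fun (dt_test_fun _ _ _ _ _ _ _ _ _ _ _).2 /test_fun /=.
  by rewrite lt_max; apply/orP; right; lra.
Qed.

(** A nonnegative solution that is at least [M] along the line [x = a] is at
least a fixed fraction of [M] at time [t0] within distance [Z] of that line.
The sign [sg] selects the side [sg * (x - a) >= 0] of the line. *)
Lemma half_line_barrier_le (R : realType) (u0 : R -> R) (u : R * R -> R)
    (u_sol : viscosity_solution u0 u) (sg a M Z t0 : R) : sg ^+ 2 = 1 -> 0 < M ->
  0 < t0 -> 0 <= Z ->
  (forall x t, 0 <= t -> 0 <= u (x, t)) -> (forall t, 0 <= t -> M <= u (a, t)) ->
  let k := (Z + 1) / t0 in
  let s0 := expR (k ^+ 2 * t0) in
  forall x, 0 <= sg * (x - a) <= Z ->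
  M * ((expR k - 1) / s0) ^+ 2 <= u (x, t0).
Proof.
move=> sg2 M0 t0_gt0 Z0 u_ge0 uM k s0 x /andP[x0 xZ].
have k0 : 0 < k by apply: divr_gt0 => //; lra.
pose d := expR k - 1.
have d0 : 0 < d by rewrite /d subr_gt0 expR_gt1.
have s00 : 0 < s0 by exact: expR_gt0.
(* [k] makes [k^2 t0 - k Z = k], so the wave is at least [exp k] at [(x, t0)].
   With [s = exp (k^2 t)], the choice of [al] and [be] maximizes
   [al * d - be * s0^2] under the constraint [al * s - be * s^2 <= 1] for all
   [s], which keeps [w] below [M] on the line. *)
pose al := 2 * d / s0 ^+ 2; pose be := d ^+ 2 / s0 ^+ 4.
have al0 : 0 < al by rewrite divr_gt0 ?mulr_gt0 ?exprn_gt0.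
have be0 : 0 < be by rewrite divr_gt0 ?exprn_gt0.
pose w := test_fun (- (M * al)) 0 0 0 (M * al) (k ^+ 2) (- (k * sg))
  (k * sg * a) (- (M * be)) (2 * k ^+ 2).
have wE q : w q = M * (al * (expR (k ^+ 2 * q.2 - k * (sg * (q.1 - a))) - 1)
    - be * expR (k ^+ 2 * q.2) ^+ 2).
  rewrite /w /test_fun -expRM_natl -[2%:R * _]/(2 * _).
  have -> : k ^+ 2 * q.2 + - (k * sg) * q.1 + k * sg * a =
    k ^+ 2 * q.2 - k * (sg * (q.1 - a)) by ring.
  have -> : 2 * (k ^+ 2 * q.2) = 2 * k ^+ 2 * q.2 by ring.
  ring.
pose D := [set q : R * R | 0 <= q.2] `&` [set q | 0 <= sg * (q.1 - a)].
have cz : continuous (fun q : R * R => sg * (q.1 - a)).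
  move=> q; apply: cvgM; first exact: cvg_cst.
  by apply: cvgB; [exact: cvg_fst|exact: cvg_cst].
have c2 : continuous (fun q : R * R => q.2) by move=> q; exact: cvg_snd.
suff wu : w (x, t0) <= u (x, t0).
  apply: le_trans wu; rewrite wE /= ler_pM2l//.
  have h : expR k <= expR (k ^+ 2 * t0 - k * (sg * (x - a))).
    rewrite ler_expR.
    have -> : k ^+ 2 * t0 = k * (Z + 1) by rewrite /k; field; rewrite gt_eqF.
    by nra.
  have -> : ((expR k - 1) / s0) ^+ 2 = al * (expR k - 1) - be * s0 ^+ 2.
    by rewrite /al /be /d; field; rewrite gt_eqF.
  by rewrite lerD2r ler_pM2l// lerD2r.
pose T := al / be / k ^+ 2.
pose L := T + `|a| + k * T.
have k20 : 0 < k ^+ 2 by rewrite exprn_gt0.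
have T0 : 0 < T by apply: divr_gt0 => //; exact: divr_gt0.
have Dx : D (x, t0) by split=> //=; exact: ltW.
apply: (comparison u_sol (D := D) (L := L)) => //.
- apply: closedI; first by apply: (preimage_closed _ (@closed_ge R 0)) => q _; exact: c2.
  by apply: (preimage_closed _ (@closed_ge R 0)) => q _; exact: cz.
- by move=> q [].
- by move=> k'; exact: Ck_test_fun.
move=> [y s] [/= s_ge0 z_ge0] uw.
set z := sg * (y - a) in z_ge0.
have w0 : 0 < w (y, s) by apply: le_lt_trans uw; exact: u_ge0.
set S := expR (k ^+ 2 * s).
set V := expR (k ^+ 2 * s - k * z).
have S0 : 0 < S by exact: expR_gt0.
have V0 : 0 < V by exact: expR_gt0.
have VS : V <= S by rewrite ler_expR; nra.
have {}w0 : 0 < al * (V - 1) - be * S ^+ 2.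
  by move: w0; rewrite wE /= pmulr_rgt0.
have S20 : 0 < be * S ^+ 2 by rewrite mulr_gt0 ?exprn_gt0.
have V1 : 1 < V.
  have : 0 < al * (V - 1) by lra.
  by rewrite pmulr_rgt0// subr_gt0.
have zs : z < k * s.
  move: V1; rewrite /V expR_gt1 => h.
  have {h} : 0 < k * (k * s - z) by lra.
  by rewrite pmulr_rgt0// subr_gt0.
have s_gt0 : 0 < s.
  have : 0 < k * s by lra.
  by rewrite pmulr_rgt0.
(* On the line, [M - w >= M (1 - d S / s0^2)^2 >= 0]. *)
have z_gt0 : 0 < z.
  rewrite lt_neqAle z_ge0 andbT eq_sym; apply/eqP => z00.
  have ya : y = a.
    have : sg * z = 0 by rewrite z00 mulr0.
    by rewrite /z mulrA -expr2 sg2 mul1r => /eqP; rewrite subr_eq0 => /eqP.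
  have : w (y, s) <= M.
    rewrite wE /= -/z z00 mulr0 subr0 -/S -[leRHS]mulr1 ler_pM2l//.
    have : 0 <= (1 - d * S / s0 ^+ 2) ^+ 2 by exact: sqr_ge0.
    have -> : (1 - d * S / s0 ^+ 2) ^+ 2 = 1 - al * S + be * S ^+ 2.
      by rewrite /al /be; field; rewrite gt_eqF.
    by nra.
  by rewrite leNgt (le_lt_trans _ uw)// ya; exact: uM.
(* [u < w] gives [exp (k^2 s) < al / be], which bounds [s]. *)
have sT : s < T.
  have h1 : be * S < al.
    have : 0 < S * (al - be * S).
      have : al * V <= al * S by rewrite ler_pM2l.
      nra.
    by rewrite pmulr_rgt0// subr_gt0.
  have h2 : S < al / be by rewrite ltr_pdivlMr// mulrC.
  rewrite /T ltr_pdivlMr//; apply: le_lt_trans h2.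
  by rewrite mulrC /S; have := expR_ge1Dx (k ^+ 2 * s); lra.
have a0 := normr_ge0 a.
have kT : k * s < k * T by rewrite ltr_pM2l.
split=> //.
- by rewrite /L; nra.
- have -> : y = a + sg * z by rewrite /z mulrA -expr2 sg2; ring.
  apply: (le_trans (ler_normD _ _)); rewrite normrM.
  have -> : `|sg| = 1.
    by apply/eqP; rewrite -sqrp_eq1// real_normK ?num_real// sg2.
  by rewrite mul1r (gtr0_norm z_gt0) /L; lra.
- apply: (filterS (P := [set q : R * R | 0 < q.2] `&`
    [set q | 0 < sg * (q.1 - a)])); first by move=> q [/ltW + /ltW].
  apply: open_nbhs_nbhs; split=> //; apply: openI.
    by apply: (open_comp _ (@open_gt R 0)) => q _; exact: c2.
  by apply: (open_comp _ (@open_gt R 0)) => q _; exact: cz.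
- rewrite dxx_test_fun (dt_test_fun _ _ _ _ _ _ _ _ _ _ _).2 /test_fun /=.
  rewrite lt_max; apply/orP; left.
  have -> : (- (k * sg)) ^+ 2 = k ^+ 2 by rewrite sqrrN exprMn sg2 mulr1.
  set e1 := expR (_ + _ + _); set e2 := expR _.
  have : 0 < M * be * k ^+ 2 * e2 by rewrite mulr_gt0 ?expR_gt0//; exact: mulr_gt0 (mulr_gt0 M0 be0) k20.
  nra.
Qed.

(** * Blow-up of the solutions *)

Theorem proposition30 (R : realType) (rho : R -> R)
    (rho_ge0 : forall x : R, 0 <= rho x)
    (rho_cont : continuous rho)
    (rho_supp : compact (closure [set x : R | rho x != 0]))
    (rho_neq0 : exists x : R, rho x != 0)
    (phi : nat -> R * R -> R)
    (phi_sol : forall n : nat, (1 <= n)%N ->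
       viscosity_solution (fun x : R => n%:R * rho (n%:R * x)) (phi n)) :
  forall x t : R, 0 < t -> (fun n : nat => phi n (x, t)) @ \oo --> +oo.
Proof.
move=> x t t0.
have [x0 rho0] := rho_neq0.
have r0 : 0 < rho x0 by rewrite lt_neqAle eq_sym rho0 rho_ge0.
pose r := rho x0 / 2.
have r_gt0 : 0 < r by rewrite divr_gt0.
have [e e0 rho_near] :
    exists2 e : R, 0 < e & forall y, `|y - x0| < e -> r < rho y.
  have : \forall y \near x0, r < rho y.
    apply: (cvgr_gt _ (rho_cont x0)).
    by rewrite /r; lra.
  by move=> /nbhs_ballP[e /= e0 h]; exists e => // y ye; apply: h;
    rewrite /ball /= distrC.
pose Z := `|x| + `|x0|.
have Z0 : 0 <= Z by rewrite addr_ge0.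
pose k := (Z + 1) / t.
pose c := ((expR k - 1) / expR (k ^+ 2 * t)) ^+ 2.
have c0 : 0 < c.
  rewrite exprn_gt0// divr_gt0 ?expR_gt0// subr_gt0 expR_gt1.
  by rewrite divr_gt0//; lra.
have lower (n : nat) : (1 <= n)%N -> n%:R * (r * c) <= phi n (x, t).
  move=> n1; have sol := phi_sol n n1.
  have n0 : 0 < n%:R :> R by rewrite ltr0n.
  have n1R : 1 <= n%:R :> R by rewrite ler1n.
  pose a := x0 / n%:R.
  (* The paraboloid [- (z - y)^2], with vertex at [y], lies below the datum. *)
  have ge0 y s : 0 <= s -> 0 <= phi n (y, s).
    move=> s0; have := @paraboloid_le R _ _ sol 0 1 y ltr01 _ y s s0.
    rewrite subrr expr0n /= mulr0 subr0; apply=> z.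
    rewrite mul1r; have := sqr_ge0 (z - y).
    by have := mulr_ge0 (ltW n0) (rho_ge0 (n%:R * z)); lra.
  have geM s : 0 <= s -> n%:R * r <= phi n (a, s).
    (* [K] makes the paraboloid [n r - K (y - a)^2] vanish at distance [e / n]
       from its vertex, so that it lies below the datum. *)
    move=> s0; pose K := n%:R * r * (n%:R / e) ^+ 2.
    have K0 : 0 < K by rewrite mulr_gt0 ?exprn_gt0 ?divr_gt0//; exact: mulr_gt0.
    have := @paraboloid_le R _ _ sol (n%:R * r) K a K0 _ a s s0.
    rewrite subrr expr0n /= mulr0 subr0; apply=> y.
    have [ye|ye] := ltP `|n%:R * y - x0| e.
      apply: (@le_trans _ _ (n%:R * r)).
        by rewrite lerBlDr lerDl mulr_ge0 ?sqr_ge0// ltW.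
      by rewrite ler_pM2l// ltW// rho_near.
    apply: (@le_trans _ _ 0); last by rewrite mulr_ge0// ltW.
    rewrite subr_le0 /K -mulrA ler_peMr//; first by rewrite ltW ?mulr_gt0.
    have -> : (n%:R / e) ^+ 2 * (y - a) ^+ 2 = (`|n%:R * y - x0| / e) ^+ 2.
      rewrite [in RHS]exprMn real_normK ?num_real// /a.
      by field; rewrite !gt_eqF.
    rewrite -[leLHS](expr1n _ 2) ler_sqr ?nnegrE ?divr_ge0 ?(ltW e0)//.
    by rewrite ler_pdivlMr// mul1r.
  have M0 : 0 < n%:R * r by rewrite mulr_gt0.
  have aZ : `|x - a| <= Z.
    apply: (le_trans (ler_normB _ _)).
    rewrite lerD2l /a normrM normfV (gtr0_norm n0).
    by rewrite ler_pdivrMr// ler_peMr.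
  rewrite mulrA.
  have [xa|xa] := leP 0 (x - a).
    apply: (half_line_barrier_le sol (sg := 1) (a := a)) => //;
      first by rewrite expr1n.
    by rewrite mul1r xa -(ger0_norm xa).
  apply: (half_line_barrier_le sol (sg := -1) (a := a)) => //;
      first by rewrite sqrrN expr1n.
  by rewrite mulN1r oppr_ge0 (ltW xa) -(ltr0_norm xa).
apply/cvgryPge => A.
have rc0 : 0 < r * c by rewrite mulr_gt0.
exists (Num.truncn (`|A| / (r * c))).+1 => //= n /= An.
apply: le_trans (lower n (leq_trans _ An)) => //.
rewrite -ler_pdivrMr//; apply: (@le_trans _ _ (`|A| / (r * c))).
  by rewrite ler_pM2r ?invr_gt0// ler_norm.
by apply: ltW; apply: lt_le_trans (truncnS_gt _) _; rewrite ler_nat.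
Qed.
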